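(* Let $f:\mathbb{R}^n\to\mathbb{R}$ be continuous and bounded, and suppose $f$ attains its minimum $\underline f:=\min_{z\in\mathbb{R}^n}f(z)$, so that $\mathfrak{M}:=\{x\in\mathbb{R}^n:f(x)=\underline f\}\neq\emptyset$. Let $t\in(0,\infty)$, $x\in\mathbb{R}^n$, $\varepsilon>0$, let $y_x^{\alpha_\varepsilon}(\cdot)$ be an $\varepsilon$-optimal trajectory starting from $x$ for the finite-horizon un-discounted problem, and let $R:=\sqrt{6\|f\|_\infty}$. Then $$\mu_t[x,\alpha_\varepsilon](\delta)\le\frac1t\left(\frac{R\,\operatorname{dist}(x,\mathfrak{M})+\varepsilon}{\delta}\right)\qquad\forall\,\delta>0.$$ In particular, for an optimal trajectory $y_x^{\alpha_*}(\cdot)$ (the case $\varepsilon=0$), $$\mu_t[x,\alpha_*](\delta)\le\frac1t\,\frac{R\,\operatorname{dist}(x,\mathfrak{M})}{\delta}\qquad\forall\,\delta>0.$$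
   Context: $\|f\|_\infty=\sup|f|$. Fix a constant $M\ge1+\sqrt{6\|f\|_\infty}$ and let $B_M$ be the closed ball of radius $M$ centered at $0$ in $\mathbb{R}^n$. Admissible controls are measurable functions $\alpha(\cdot):[0,\infty)\to B_M$; the trajectory is $y_x^\alpha(s)=x+\int_0^s\alpha(r)\,dr$. The finite-horizon un-discounted problem has value function $$u(x,t)=\inf_\alpha\int_0^t\Big(\tfrac12|\alpha(s)|^2+f(y_x^\alpha(s))\Big)\,ds.$$ For $\varepsilon\ge0$, a trajectory $y_x^{\alpha_\varepsilon}$ with admissible control $\alpha_\varepsilon$ is $\varepsilon$-optimal if $\int_0^t(\tfrac12|\alpha_\varepsilon(s)|^2+f(y_x^{\alpha_\varepsilon}(s)))\,ds\le u(x,t)+\varepsilon$; it is optimal if this holds with $\varepsilon=0$. For $\delta\ge0$ let $K_\delta:=\{y\in\mathbb{R}^n:f(y)\le\underline f+\delta\}$ and $K_\delta^c=\mathbb{R}^n\setminus K_\delta$. The occupation measure is $$\mu_t[x,\alpha](\delta):=\frac1t\int_0^t\mathbf{1}_{K_\delta^c}(y_x^\alpha(s))\,ds.$$ $\operatorname{dist}(x,\mathfrak{M})=\inf_{z\in\mathfrak{M}}|x-z|$. *)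

(* Defs.v *)
From HB Require Import structures.
From mathcomp Require Import all_boot all_order all_algebra.
From mathcomp Require Import all_classical all_reals all_analysis.

Set Implicit Arguments.
Unset Strict Implicit.
Unset Printing Implicit Defensive.

Import Order.TTheory GRing.Theory Num.Theory.
Import numFieldNormedType.Exports.

Local Open Scope classical_set_scope.
Local Open Scope ring_scope.

(* The real line with its Lebesgue-measurable (not merely Borel) subsets;
   this is the domain of [completed_lebesgue_measure]. *)
Notation lebesgueType R :=
  (caratheodory_type ((wlength (@idfun R))^*)%mu).

Definition borel_rV (R : realType) (n : nat) :=
  g_sigma_algebraType (@open 'rV[R]_n).

(* The library norm `|x| on row vectors is the maximum norm. *)
Definition enorm (R : realType) (n : nat) (x : 'rV[R]_n) : R :=
  Num.sqrt (\sum_(i < n) x 0 i ^+ 2).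

Definition leb_int (R : realType) (a b : R) (g : R -> R) : R :=
  Rintegral (@completed_lebesgue_measure R) `[a, b] g.

Definition supnorm (R : realType) (n : nat) (f : 'rV[R]_n -> R) : R :=
  sup [set `|f y| | y in setT].

(* Equal to the minimum of f whenever f attains it. *)
Definition minval (R : realType) (n : nat) (f : 'rV[R]_n -> R) : R :=
  inf [set f y | y in setT].

Definition argmin_set (R : realType) (n : nat) (f : 'rV[R]_n -> R) :
  set 'rV[R]_n := [set y | f y = minval f].

Definition dist (R : realType) (n : nat) (x : 'rV[R]_n) (A : set 'rV[R]_n) : R :=
  inf [set enorm (x - z) | z in A].

(* Controls are functions on [0, +oo): values at negative times are never
   constrained nor used. *)
Definition admissible (R : realType) (n : nat) (M : R) (alpha : R -> 'rV[R]_n) :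
  Prop :=
  @measurable_fun _ _ (lebesgueType R) (borel_rV R n) `[(0 : R), +oo[ alpha /\
  forall s : R, 0 <= s -> enorm (alpha s) <= M.

Definition trajectory (R : realType) (n : nat) (x : 'rV[R]_n)
    (alpha : R -> 'rV[R]_n) (s : R) : 'rV[R]_n :=
  x + \row_(i < n) leb_int 0 s (fun r => alpha r 0 i).

Definition cost (R : realType) (n : nat) (f : 'rV[R]_n -> R) (x : 'rV[R]_n)
    (t : R) (alpha : R -> 'rV[R]_n) : R :=
  leb_int 0 t
    (fun s => 2^-1 * enorm (alpha s) ^+ 2 + f (trajectory x alpha s)).

Definition value (R : realType) (n : nat) (M : R) (f : 'rV[R]_n -> R)
    (x : 'rV[R]_n) (t : R) : R :=
  inf [set cost f x t alpha | alpha in [set alpha | admissible M alpha]].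

Definition eps_optimal (R : realType) (n : nat) (M : R) (f : 'rV[R]_n -> R)
    (x : 'rV[R]_n) (t eps : R) (alpha : R -> 'rV[R]_n) : Prop :=
  admissible M alpha /\ cost f x t alpha <= value M f x t + eps.

Definition optimal (R : realType) (n : nat) (M : R) (f : 'rV[R]_n -> R)
    (x : 'rV[R]_n) (t : R) (alpha : R -> 'rV[R]_n) : Prop :=
  eps_optimal M f x t 0 alpha.

Definition sublevel (R : realType) (n : nat) (f : 'rV[R]_n -> R) (delta : R) :
  set 'rV[R]_n := [set y | f y <= minval f + delta].

Definition occupation (R : realType) (n : nat) (f : 'rV[R]_n -> R) (t : R)
    (x : 'rV[R]_n) (alpha : R -> 'rV[R]_n) (delta : R) : R :=
  t^-1 * leb_int 0 t
    (fun s => \1_(~` sublevel f delta) (trajectory x alpha s)).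

(* Main.v *)
Require Import Defs.
From HB Require Import structures.
From mathcomp Require Import all_boot all_order all_algebra.
From mathcomp Require Import all_classical all_reals all_analysis.
From mathcomp Require Import measurable_realfun ring lra.

Set Implicit Arguments.
Unset Strict Implicit.
Unset Printing Implicit Defensive.

Import Order.TTheory GRing.Theory Num.Theory.
Import numFieldNormedType.Exports.

Local Open Scope classical_set_scope.
Local Open Scope ring_scope.

(** The cost of a control dominates the occupation time.  The kinetic term is
    nonnegative, f is at least its minimum m everywhere, and f exceeds
    m + delta whenever the trajectory lies outside the sublevel set, so a
    control whose trajectory spends time theta there costs at least
    t m + delta theta (occupation_le_cost).

    Conversely, the value function is at most t m + R |x - z| for every
    minimizer z, where R = sqrt (6 F) and F is the sup norm of f
    (value_le_straight_line).  It suffices to run straight from x to z at speed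
    R and to stay there.  The run lasts |x - z| / R, during which the running
    cost exceeds m by at most R^2 / 2 + 2 F = 5 R^2 / 6, so that the excess
    cost is at most 5/6 R |x - z|.  If t is too short to reach z, the same
    bound holds a fortiori.  If R = 0 then f vanishes identically and standing
    still is optimal.

    For an eps-optimal control the two estimates give
    delta theta <= R |x - z| + eps, and the infimum over z concludes.

    The analytic content is the integrability of the running cost along an
    arbitrary bounded measurable control: the trajectory is Lipschitz, hence
    f composed with it is continuous and bounded. *)

(** * Integration with respect to the completed Lebesgue measure *)

Section Lebesgue.
Variable R : realType.
Implicit Types (a b s k T : R) (g : R -> R).
Local Notation mu := (@completed_lebesgue_measure R).

Lemma borel_lebesgue_measurable (A : set (measurableTypeR R)) :
  measurable A -> measurable (A : set (lebesgueType R)).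
Proof. exact: sub_caratheodory. Qed.

Lemma measurable_itv_lebesgue (i : interval R) :
  measurable ([set` i] : set (lebesgueType R)).
Proof. by apply: borel_lebesgue_measurable; exact: measurable_itv. Qed.

Lemma continuous_lebesgue_measurable g :
  continuous g -> measurable_fun (setT : set (lebesgueType R)) g.
Proof.
move=> /continuous_measurable_fun mg _ B mB.
by apply: borel_lebesgue_measurable; exact: mg.
Qed.

(** Both Lebesgue measures are restrictions of one outer measure, so the
    length formula transfers by conversion. *)
Lemma completed_lebesgue_measure_itv a b (l r : bool) : a <= b ->
  mu [set` Interval (BSide l a) (BSide r b)] = (b - a)%:E.
Proof.
move=> ab; rewrite [LHS](lebesgue_measure_itv (Interval _ _))/= lte_fin.
case: ltP => // ba; have -> : a = b by apply/le_anti; rewrite ab ba.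
by rewrite subrr.
Qed.

Lemma bounded_integrable a b (l r : bool) K g :
    a <= b ->
    let ab : set (lebesgueType R) := [set` Interval (BSide l a) (BSide r b)] in
    measurable_fun ab g -> (forall s, ab s -> `|g s| <= K) ->
  mu.-integrable ab (EFin \o g).
Proof.
move=> leab ab mg gK; apply: measurable_bounded_integrable => //.
- exact: measurable_itv_lebesgue.
- by rewrite [ltLHS]completed_lebesgue_measure_itv ?ltry.
- exists K; split; [exact: num_real|] => N KN s /= sab.
  exact: le_trans (gK _ sab) (ltW KN).
Qed.

Lemma Rintegral_itv_cst a b (l r : bool) k : a <= b ->
  Rintegral mu [set` Interval (BSide l a) (BSide r b)] (cst k) = k * (b - a).
Proof.
move=> ab; rewrite Rintegral_cst; last exact: measurable_itv_lebesgue.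
by rewrite [X in fine X]completed_lebesgue_measure_itv.
Qed.

(** Step functions serve both to integrate the control that stops at time [T]
    and to bound its running cost from above. *)
Lemma leb_int_step s T k : 0 <= s -> 0 <= T ->
  leb_int 0 s (cst k \_ `]-oo, T]) = k * Num.min s T.
Proof.
move=> s0 T0; rewrite /leb_int -Rintegral_mkcondr.
have -> : `[0, s] `&` `]-oo, T] = `[0, Num.min s T]%classic.
  apply/seteqP; split => r /=; rewrite !in_itv/= le_min.
    by move=> [/andP[-> ->] ->].
  by move=> /and3P[-> -> ->].
by rewrite [LHS]Rintegral_itv_cst ?subr0// le_min s0.
Qed.

(** For [s = 0] the domain is a single point, on which every function is
    measurable. *)
Lemma leb_int_le0 s g : s <= 0 -> leb_int 0 s g = 0.
Proof.
rewrite le_eqVlt => /predU1P[->|s0]; last first.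
  by rewrite /leb_int set_itv_ge ?Rintegral_set0// bnd_simp -ltNge.
rewrite /leb_int /Rintegral null_set_integral//.
- exact: measurable_itv_lebesgue.
- by rewrite set_itv1; exact: measurable_fun_set1.
- by rewrite [LHS]completed_lebesgue_measure_itv// subrr.
Qed.

End Lebesgue.

(** * Euclidean norm and Borel functions on row vectors *)

Section Euclidean.
Variables (R : realType) (n : nat).
Implicit Types (x v : 'rV[R]_n).

Lemma enorm_ge0 x : 0 <= enorm x.
Proof. exact: sqrtr_ge0. Qed.

Lemma sqr_enorm x : enorm x ^+ 2 = \sum_(i < n) x 0 i ^+ 2.
Proof. by rewrite sqr_sqrtr// sumr_ge0// => i _; exact: sqr_ge0. Qed.

Lemma coord_le_enorm x i : `|x 0 i| <= enorm x.
Proof.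
rewrite -ler_sqr ?nnegrE ?enorm_ge0// real_normK ?num_real// sqr_enorm.
by rewrite (bigD1 i)//= lerDl sumr_ge0// => j _; exact: sqr_ge0.
Qed.

Lemma enorm0_eq0 x : enorm x = 0 -> x = 0.
Proof.
move=> x0; apply/rowP => i; rewrite mxE; apply/normr0_eq0/le_anti.
by rewrite normr_ge0 -x0 coord_le_enorm.
Qed.

Lemma enormZ (k : R) x : enorm (k *: x) = `|k| * enorm x.
Proof.
rewrite /enorm -sqrtr_sqr -sqrtrM ?sqr_ge0// mulr_sumr; congr Num.sqrt.
apply: eq_bigr => i _; by rewrite mxE exprMn.
Qed.

Lemma enorm0 : enorm (0 : 'rV[R]_n) = 0.
Proof. by rewrite -[0](scale0r 0) enormZ normr0 mul0r. Qed.

Lemma enormN x : enorm (- x) = enorm x.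
Proof. by rewrite -scaleN1r enormZ normrN1 mul1r. Qed.

Lemma continuous_borel_rV_measurable (g : 'rV[R]_n -> R) :
  continuous g -> measurable_fun (setT : set (borel_rV R n)) g.
Proof.
move=> /continuousP cg; apply: (measurability _ (RGenOpens.measurableE R)).
move=> _ [_ [a [b ->] <-]]; rewrite setTI; apply: sub_sigma_algebra.
exact/cg/interval_open.
Qed.

End Euclidean.

(** * Trajectories of admissible controls *)

Lemma itv_left_le (R : realType) (l : bool) (a s : R) (e : itv_bound R) :
  s \in Interval (BSide l a) e -> a <= s.
Proof. by case: l => /andP[]; rewrite ?bnd_simp => // /ltW. Qed.

Section Trajectory.
Variables (R : realType) (n : nat) (M : R) (alpha : R -> 'rV[R]_n).
Hypothesis alphaM : admissible M alpha.
Implicit Types (a b s t : R) (x : 'rV[R]_n).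

Lemma admissible_coord_measurable a (l : bool) (e : itv_bound R) i : 0 <= a ->
  measurable_fun ([set` Interval (BSide l a) e] : set (lebesgueType R))
    (fun r => alpha r 0 i).
Proof.
move=> a0; apply: (@measurable_funS _ _ (lebesgueType R) _ `[0, +oo[).
- exact: measurable_itv_lebesgue.
- by move=> r /= /itv_left_le ar; rewrite in_itv/= andbT (le_trans a0).
- exact: measurableT_comp (continuous_borel_rV_measurable
    (@coord_continuous _ _ _ 0 i)) alphaM.1.
Qed.

Lemma admissible_sqr_enorm_measurable t :
  measurable_fun (`[0, t] : set (lebesgueType R)) (fun s => enorm (alpha s) ^+ 2).
Proof.
rewrite (_ : (fun _ => _) = fun s => \sum_(i < n) alpha s 0 i ^+ 2); last first.
  by apply/funext => s; exact: sqr_enorm.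
by apply: measurable_sum => i; apply: measurable_funX;
  exact: admissible_coord_measurable.
Qed.

Lemma admissible_radius_ge0 : 0 <= M.
Proof. exact: le_trans (enorm_ge0 _) (alphaM.2 0 (lexx 0)). Qed.

(** Adding up the integrals over `[0, a] and `]a, b] leaves the integral over
    `]a, b] of a function bounded by [M]. *)
Lemma leb_int_coord_lipschitz a b i : 0 <= a -> a <= b ->
  `|leb_int 0 b (fun r => alpha r 0 i) - leb_int 0 a (fun r => alpha r 0 i)|
    <= M * (b - a).
Proof.
move=> a0 ab; pose mu := @completed_lebesgue_measure R.
have coordM s : 0 <= s -> `|alpha s 0 i| <= M.
  by move=> s0; rewrite (le_trans (coord_le_enorm _ _))// alphaM.2.
have int_coord c d (l r : bool) : 0 <= c -> c <= d ->
    mu.-integrable [set` Interval (BSide l c) (BSide r d)]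
      (EFin \o (fun r => alpha r 0 i)).
  move=> c0 cd; apply: (@bounded_integrable _ _ _ _ _ M) => //.
    exact: admissible_coord_measurable.
  by move=> s /= /itv_left_le cs; exact/coordM/(le_trans c0).
have b0 := le_trans a0 ab.
have eab : `[0, b]%classic = `[0, a] `|` `]a, b] :> set R.
  by rewrite -itv_bndbnd_setU ?bnd_simp.
rewrite {1}/leb_int eab Rintegral_setU; last 4 first.
- exact: measurable_itv_lebesgue.
- exact: measurable_itv_lebesgue.
- by rewrite -eab; exact: int_coord.
- rewrite disj_set2E; apply/eqP/seteqP; split => // r [] /=.
  by rewrite !in_itv/= => /andP[_ ra] /andP[/lt_le_trans/(_ ra)]; rewrite ltxx.
rewrite -/(leb_int 0 a _) addrAC subrr add0r.
apply: le_trans (le_normr_Rintegral (measurable_itv_lebesgue _) _) _.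
  exact: int_coord.
rewrite -(@Rintegral_itv_cst _ _ _ false false)//; apply: le_Rintegral.
- exact: measurable_itv_lebesgue.
- exact/integrable_norm/int_coord.
- exact: (@bounded_integrable _ _ _ _ _ `|M|).
- by move=> s /= /itv_left_le as_; exact/coordM/(le_trans a0).
Qed.

(** The trajectory is Lipschitz on nonnegative times and constant before 0;
    continuity on the whole line lets Borel measurability of continuous
    functions apply without restricting to a subspace. *)
Lemma trajectory_continuous x : continuous (trajectory x alpha).
Proof.
have traj_max s : trajectory x alpha s = trajectory x alpha (Num.max 0 s).
  case: (leP 0 s) => // s0; rewrite /trajectory; congr (_ + _).
  apply/rowP => i; rewrite !mxE.
  by rewrite !leb_int_le0// ltW.
have lip s s' i : `|trajectory x alpha s 0 i - trajectory x alpha s' 0 i| <=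
    M * `|s - s'|.
  wlog ss : s s' / s <= s'.
    move=> h; have [|/ltW] := leP s s'; first exact: h.
    by move=> /h; rewrite distrC [`|s' - s|]distrC.
  rewrite distrC traj_max [trajectory x alpha s]traj_max !mxE.
  rewrite [_ + _ - _]addrAC opprD addrA subrr add0r addrC.
  apply: le_trans (leb_int_coord_lipschitz _ _ _) _.
  - by rewrite le_max lexx.
  - by rewrite ge_max !le_max lexx ss orbT.
  - rewrite ler_wpM2l ?admissible_radius_ge0// distrC ger0_norm ?subr_ge0//.
    by case: (leP 0 s) => s0; case: (leP 0 s') => s'0; lra.
move=> s; apply/cvg_ballP => e e0.
(* M may be 0: divide by M + 1 instead. *)
have M1 : 0 < M + 1 by rewrite ltr_wpDl// admissible_radius_ge0.
near=> s'; split => // i j; rewrite ord1 /ball/=.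
apply: le_lt_trans (lip _ _ _) _.
apply: (@le_lt_trans _ _ ((M + 1) * `|s - s'|)).
  by rewrite ler_wpM2r// lerDl.
rewrite mulrC -ltr_pdivlMr//; near: s'.
apply: cvgr_dist_lt; last by rewrite divr_gt0.
exact: cvg_id.
Unshelve. all: by end_near. Qed.

End Trajectory.

(** * Minimum and sup norm of the potential *)

Section Potential.
Variables (R : realType) (n : nat) (f : 'rV[R]_n -> R).

Lemma minval_minimizer z : (forall y, f z <= f y) -> minval f = f z.
Proof.
move=> fz; apply/le_anti/andP; split.
  by apply: ge_inf; [exists (f z) => _ [y _ <-]|exists z].
by apply: lb_le_inf; [exists (f z), z|move=> _ [y _ <-]].
Qed.

Lemma minval_le y : (exists z, forall y, f z <= f y) -> minval f <= f y.
Proof. by move=> [z fz]; rewrite (minval_minimizer fz). Qed.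

Lemma normr_le_supnorm y : bounded_fun f -> `|f y| <= supnorm f.
Proof.
move=> [K [_ fK]]; apply: ub_le_sup; last by exists y.
by exists (K + 1) => _ [z _ <-]; apply: fK => //; rewrite ltrDl.
Qed.

End Potential.

(** * The cost dominates the occupation time *)

Section Cost.
Variables (R : realType) (n : nat) (f : 'rV[R]_n -> R) (M t : R) (x : 'rV[R]_n).
Hypotheses (f_cont : continuous f) (f_bounded : bounded_fun f).
Hypotheses (f_min : exists z, forall y, f z <= f y) (t_gt0 : 0 < t).
Implicit Types (alpha : R -> 'rV[R]_n) (delta : R).
Local Notation mu := (@completed_lebesgue_measure R).

Lemma trajectory_comp_measurable alpha (D : set R) :
  admissible M alpha ->
  measurable_fun (D : set (lebesgueType R)) (f \o trajectory x alpha).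
Proof.
move=> aM; apply: (@measurable_funTS _ _ (lebesgueType R)).
apply: continuous_lebesgue_measurable => s.
by apply: continuous_comp; [exact: trajectory_continuous aM _ _|exact: f_cont].
Qed.

Lemma running_cost_integrable alpha : admissible M alpha ->
  mu.-integrable `[0, t] (EFin \o
    (fun s => 2^-1 * enorm (alpha s) ^+ 2 + f (trajectory x alpha s))).
Proof.
move=> aM.
apply: (@bounded_integrable _ _ _ _ _ (2^-1 * M ^+ 2 + supnorm f)).
- exact: ltW.
- apply: measurable_funD; last exact: trajectory_comp_measurable.
  apply: measurable_funM; first exact: measurable_cst.
  exact: admissible_sqr_enorm_measurable aM _.
- move=> s /= /itv_left_le s0; rewrite (le_trans (ler_normD _ _))// lerD//.
    rewrite ger0_norm; last by rewrite mulr_ge0 ?invr_ge0 ?sqr_ge0.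
    rewrite ler_wpM2l ?invr_ge0//.
    by rewrite lerXn2r ?nnegrE ?enorm_ge0 ?(admissible_radius_ge0 aM)// aM.2.
  exact: normr_le_supnorm.
Qed.

(** Pointwise, the running cost is at least
    [minval f + delta * 1_(f > minval f + delta)].  The case [delta = 0] is
    the lower bound that makes the value function a genuine infimum. *)
Lemma occupation_le_cost alpha delta : admissible M alpha -> 0 <= delta ->
  minval f * t + delta * (t * occupation f t x alpha delta) <=
    cost f x t alpha.
Proof.
move=> aM delta0.
have t0 := ltW t_gt0.
pose ind s : R := \1_(~` sublevel f delta) (trajectory x alpha s).
have int_ind : mu.-integrable `[0, t] (EFin \o ind).
  apply: (@bounded_integrable _ _ _ _ _ 1) => //; last first.
    by move=> s _; rewrite /ind indicE; case: (_ \in _); rewrite ?normr1 ?normr0.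
  rewrite (_ : ind =
      \1_((f \o trajectory x alpha) @^-1` `]minval f + delta, +oo[)).
    apply: measurable_indic; rewrite -[_ @^-1` _]setTI.
    have /(_ measurableT) := @trajectory_comp_measurable alpha setT aM.
    by apply; exact: measurable_itv.
  apply/funext => s; rewrite /ind !indicE; congr (nat_of_bool _)%:R.
  apply: asbool_equiv_eq => /=; rewrite in_itv/= andbT ltNge.
  by split => /negP.
have int_cst : mu.-integrable `[0, t] (EFin \o cst (minval f)).
  exact: (@bounded_integrable _ _ _ _ _ `|minval f|).
have int_dind : mu.-integrable `[0, t] (fun s => delta%:E * (ind s)%:E)%E.
  exact: (integrableZl (measurable_itv_lebesgue _) delta int_ind).
rewrite /occupation mulVKf ?gt_eqF//.
rewrite -[X in minval f * X]subr0 -(@Rintegral_itv_cst _ _ _ true false)//.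
rewrite /leb_int -RintegralZl//; last exact: measurable_itv_lebesgue.
rewrite -RintegralD//; last exact: measurable_itv_lebesgue.
apply: le_Rintegral.
- exact: measurable_itv_lebesgue.
- exact: (integrableD (measurable_itv_lebesgue _) int_cst int_dind).
- exact: running_cost_integrable.
- move=> s _; rewrite -[leLHS]add0r lerD ?mulr_ge0 ?invr_ge0 ?enorm_ge0//.
  rewrite /= /ind indicE; case: (boolP (_ \in _)) => [|_].
    by move/set_mem => /negP; rewrite -ltNge mulr1 => /ltW.
  by rewrite mulr0 addr0; exact: minval_le.
Qed.

Lemma value_le_cost alpha : admissible M alpha ->
  value M f x t <= cost f x t alpha.
Proof.
move=> aM; apply: ge_inf; last by exists alpha.
exists (minval f * t) => _ [beta bM <-].
by apply: le_trans (occupation_le_cost bM (lexx 0)); rewrite mul0r addr0.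
Qed.

End Cost.

(** * Running straight to a minimizer *)

Section Dash.
Variables (R : realType) (n : nat).
Implicit Types (v x : 'rV[R]_n) (T s : R).

Definition dash v T s : 'rV[R]_n := if s <= T then v else 0.

Lemma dash_admissible M v T : enorm v <= M -> admissible M (dash v T).
Proof.
move=> vM; split => [|s _]; rewrite /dash; last first.
  by case: ifP => // _; rewrite enorm0 (le_trans (enorm_ge0 v)).
apply: (@measurable_funTS _ _ (lebesgueType R) (borel_rV R n)).
apply: measurable_fun_ifT; [|exact: measurable_cst..].
apply: (@measurable_fun_bool _ (lebesgueType R) _ _ true).
rewrite setTI (_ : _ @^-1` _ = `]-oo, T]%classic).
  exact: measurable_itv_lebesgue.
by apply/seteqP; split => s /=; rewrite in_itv.
Qed.

(** The minimum covers both phases: motion until [T], then rest at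
    [x + T *: v]. *)
Lemma dash_trajectory x v T s : 0 <= T -> 0 <= s ->
  trajectory x (dash v T) s = x + Num.min s T *: v.
Proof.
move=> T0 s0; congr (_ + _); apply/rowP => i; rewrite !mxE mulrC.
rewrite -leb_int_step//; congr leb_int; apply/funext => r.
by rewrite patchE mem_setE in_itv/= /dash; case: ifP => // _; rewrite mxE.
Qed.

(** The running cost exceeds [minval f] by at most [enorm v ^+ 2 / 2 + K]
    during the run and by nothing afterwards.  Since the horizon enters only
    through [min t T <= T], the bound covers horizons too short for the run. *)
Lemma dash_cost (f : 'rV[R]_n -> R) (M K t T : R) x v :
    continuous f -> bounded_fun f -> (exists z, forall y, f z <= f y) ->
    0 < t -> 0 <= T -> enorm v <= M ->
    (forall y, f y <= minval f + K) -> f (x + T *: v) = minval f ->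
  cost f x t (dash v T) <= minval f * t + T * (2^-1 * enorm v ^+ 2 + K).
Proof.
move=> f_cont f_bounded f_min t0 T0 vM fK fT.
have K0 : 0 <= K by rewrite -(lerD2l (minval f)) addr0 -[leLHS]fT.
set c := 2^-1 * enorm v ^+ 2 + K.
have c0 : 0 <= c by rewrite addr_ge0// mulr_ge0 ?invr_ge0 ?sqr_ge0.
have t0' := ltW t0.
pose mu := @completed_lebesgue_measure R.
have int_step : mu.-integrable `[0, t] (EFin \o (cst c \_ `]-oo, T])).
  apply: (@bounded_integrable _ _ _ _ _ c) => //.
    apply: (@measurable_funTS _ _ (lebesgueType R)).
    apply/(measurable_restrictT _ (measurable_itv_lebesgue _)).
    exact: measurable_cst.
  by move=> s _; rewrite patchE; case: ifP => _; rewrite ?normr0// ger0_norm.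
have int_cst : mu.-integrable `[0, t] (EFin \o cst (minval f)).
  exact: (@bounded_integrable _ _ _ _ _ `|minval f|).
apply: (@le_trans _ _ (minval f * t + c * Num.min t T)); last first.
  by rewrite lerD2l mulrC ler_wpM2r// ge_min lexx orbT.
rewrite -leb_int_step// -[X in minval f * X]subr0.
rewrite -(@Rintegral_itv_cst _ _ _ true false)//.
rewrite /leb_int -RintegralD//; last exact: measurable_itv_lebesgue.
apply: le_Rintegral.
- exact: measurable_itv_lebesgue.
- exact/(running_cost_integrable x f_cont f_bounded t0)/dash_admissible/vM.
- exact: (integrableD (measurable_itv_lebesgue _) int_cst int_step).
- move=> s /= /itv_left_le s0.
  rewrite dash_trajectory//= mem_setE in_itv/= /dash.
  case: (leP s T) => sT; first by rewrite addrCA lerD2l fK.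
  by rewrite enorm0 expr0n mulr0 add0r addr0 fT.
Qed.

End Dash.

Section Value.
Variables (R : realType) (n : nat) (f : 'rV[R]_n -> R) (M t : R) (x : 'rV[R]_n).
Hypotheses (f_cont : continuous f) (f_bounded : bounded_fun f).
Hypotheses (f_min : exists z, forall y, f z <= f y) (t_gt0 : 0 < t).
Hypothesis M_large : Num.sqrt (6 * supnorm f) <= M.

(** The speed [c = sqrt (6 F)] turns the excess rate [c^2 / 2 + 2 F] into
    [5/6 c^2], hence the excess cost of a run of duration [d / c] into
    [5/6 c d].  When [c d = 0] the control 0 is used: either [x] is the
    minimizer [z], or [f] is identically 0. *)
Lemma value_le_straight_line z : argmin_set f z ->
  value M f x t <= minval f * t + Num.sqrt (6 * supnorm f) * enorm (x - z).
Proof.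
move=> /= fz; set F := supnorm f; set c := Num.sqrt _; set d := enorm _.
have F0 : 0 <= F by rewrite (le_trans _ (normr_le_supnorm x f_bounded)).
have c0 : 0 <= c by exact: sqrtr_ge0.
have d0 : 0 <= d by exact: enorm_ge0.
have c2 : c ^+ 2 = 6 * F by rewrite sqr_sqrtr// mulr_ge0.
have fF y : f y <= minval f + 2 * F.
  have := normr_le_supnorm y f_bounded; have := normr_le_supnorm z f_bounded.
  by rewrite -/F -fz !ler_norml => /andP[? ?] /andP[? ?]; lra.
have dashP T v : 0 <= T -> enorm v <= M -> f (x + T *: v) = minval f ->
    value M f x t <= minval f * t + T * (2^-1 * enorm v ^+ 2 + 2 * F).
  move=> T0 vM fT.
  apply: le_trans (dash_cost f_cont f_bounded f_min t_gt0 T0 vM fF fT).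
  by apply: value_le_cost => //; exact: dash_admissible.
have [cd0|] := eqVneq (c * d) 0.
  rewrite cd0 addr0 (le_trans (dashP 0 0 _ _ _))// ?mul0r ?addr0 ?enorm0//.
    exact: le_trans M_large.
  rewrite scale0r addr0; move/eqP: cd0; rewrite mulf_eq0 => /orP[] /eqP.
    move=> c00; have F00 : F = 0 by move: c2; rewrite c00 expr0n/= => ?; lra.
    by apply/le_anti; rewrite minval_le// (le_trans (fF x))// F00 mulr0 addr0.
  by move/enorm0_eq0/subr0_eq => ->.
rewrite mulf_eq0 negb_or => /andP[cN0 dN0].
have cgt0 : 0 < c by rewrite lt_neqAle eq_sym cN0.
have dgt0 : 0 < d by rewrite lt_neqAle eq_sym dN0.
have vc : enorm ((c / d) *: (z - x)) = c.
  rewrite enormZ -enormN opprB -/d ger0_norm ?divr_ge0//.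
  by rewrite -mulrA mulVf ?mulr1.
apply: le_trans (dashP (d / c) ((c / d) *: (z - x)) _ _ _) _.
- by rewrite divr_ge0.
- by rewrite vc.
- rewrite scalerA mulrA divfK// mulfV// scale1r addrC subrK.
  by rewrite -fz.
- rewrite vc lerD2l.
  have -> : F = c ^+ 2 / 6 by rewrite c2 mulrC mulKf.
  rewrite (_ : _ * _ = (5 / 6) * (c * d)); last by field; rewrite cN0.
  by rewrite ler_piMl ?mulr_ge0//; lra.
Qed.

End Value.

(** * Occupation time of nearly optimal trajectories *)

(** Stated for every real [eps], so that [eps = 0] gives the optimal case. *)
Lemma occupation_le_eps_optimal (R : realType) (n : nat) (f : 'rV[R]_n -> R)
    (M : R) (f_cont : continuous f) (f_bounded : bounded_fun f)
    (f_min : exists z, forall y, f z <= f y)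
    (M_large : Num.sqrt (6 * supnorm f) <= M)
    (t : R) (t_gt0 : 0 < t) (x : 'rV[R]_n) (eps : R) (alpha : R -> 'rV[R]_n) :
  eps_optimal M f x t eps alpha -> forall delta, 0 < delta ->
  occupation f t x alpha delta <=
    t^-1 * ((Num.sqrt (6 * supnorm f) * dist x (argmin_set f) + eps) / delta).
Proof.
move=> [aM a_opt] delta delta0; set c := Num.sqrt _.
set occ := occupation _ _ _ _ _.
have occ_z z : argmin_set f z -> delta * (t * occ) - eps <= c * enorm (x - z).
  move=> fz.
  have := occupation_le_cost x f_cont f_bounded f_min t_gt0 aM (ltW delta0).
  have := value_le_straight_line x f_cont f_bounded f_min t_gt0 M_large fz.
  by rewrite -/occ -/c; lra.
have [z fz] := f_min.
have z_argmin : argmin_set f z by rewrite /argmin_set/= (minval_minimizer fz).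
suff : delta * (t * occ) - eps <= c * dist x (argmin_set f).
  rewrite ler_pdivlMl// ler_pdivlMr//; lra.
have c_ge0 : 0 <= c by exact: sqrtr_ge0.
(* The infimum commutes with multiplication by c, by division when c > 0. *)
have [c_eq0|c_neq0] := eqVneq c 0.
  by rewrite (le_trans (occ_z _ z_argmin))// c_eq0 !mul0r.
have c_gt0 : 0 < c by rewrite lt_neqAle eq_sym c_neq0.
rewrite -ler_pdivrMl//; apply: lb_le_inf.
  by exists (enorm (x - z)), z.
by move=> _ [y fy <-]; rewrite ler_pdivrMl// occ_z.
Qed.

Theorem theorem3p6 (R : realType) (n : nat) (f : 'rV[R]_n -> R) (M : R)
    (f_cont : continuous f)
    (f_bounded : bounded_fun f)
    (f_min : exists z, forall y, f z <= f y)
    (M_large : 1 + Num.sqrt (6 * supnorm f) <= M)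
    (t : R) (t_gt0 : 0 < t) (x : 'rV[R]_n) :
  (forall (eps : R) (alpha : R -> 'rV[R]_n),
      0 < eps -> eps_optimal M f x t eps alpha ->
      forall delta : R, 0 < delta ->
        occupation f t x alpha delta <=
          t^-1 * ((Num.sqrt (6 * supnorm f) * dist x (argmin_set f) + eps)
                  / delta)) /\
  (forall alpha : R -> 'rV[R]_n,
      optimal M f x t alpha ->
      forall delta : R, 0 < delta ->
        occupation f t x alpha delta <=
          t^-1 * (Num.sqrt (6 * supnorm f) * dist x (argmin_set f) / delta)).
Proof.
have M_large' : Num.sqrt (6 * supnorm f) <= M.
  by apply: le_trans M_large; rewrite lerDr.
split=> [eps alpha _ aO delta delta0|alpha aO delta delta0].
  exact: (occupation_le_eps_optimal f_cont f_bounded f_min M_large').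
rewrite -[X in X / delta]addr0.
exact: (occupation_le_eps_optimal f_cont f_bounded f_min M_large').
Qed.
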